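(* Let $X$ be a polyhedral space and let $Y$ be a linear subspace of $X$ (with the norm inherited from $X$). Let $f \in sm(B_{Y^*})$ be a smooth functional on $Y$. Then there exists $\widetilde{f} \in sm(B_{X^*})$ with $\widetilde{f}|_Y = f$ (that is, $f$ extends to a norm-preserving smooth functional on $X$) if and only if $f$ attains its absolute norm at an extreme point of $B_Y$ which is also an extreme point of $B_X$, i.e. there exists $y_0 \in A_f$ with $y_0 \in ext(B_Y) \cap ext(B_X)$.
   Context: All spaces are real and finite-dimensional. For a normed space $Z$, $B_Z$ and $S_Z$ denote the closed unit ball and the unit sphere, $Z^*$ is the dual space with the dual norm, and $ext(B_Z)$ is the set of extreme points of $B_Z$. A polyhedral space is a finite-dimensional real Banach space $X$ such that $B_X$ is a polyhedron; equivalently, $ext(B_X)$ is finite. A point $z \in S_Z$ is smooth if there is exactly one $\varphi \in S_{Z^*}$ with $\varphi(z) = 1$; $sm(B_Z)$ denotes the set of all smooth points lying in $S_Z$. A smooth functional on $Z$ is an element of $sm(B_{Z^*})$ (in particular it has norm $1$), i.e. a smooth point of the normed space $Z^*$. For $f \in Z^*$, the absolute norm attainment set is $A_f = \{z \in S_Z : f(z) = \|f\|\}$; ''$f$ attains its absolute norm at $z$'' means $z \in A_f$. *)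

(* Defs.v *)
From HB Require Import structures.
From mathcomp Require Import all_boot all_order all_algebra.
From mathcomp Require Import all_classical all_reals all_analysis.

Set Implicit Arguments.
Unset Strict Implicit.
Unset Printing Implicit Defensive.
Import Order.TTheory GRing.Theory Num.Theory.
Import numFieldNormedType.Exports.
Import VectorInternalTheory.
Local Open Scope classical_set_scope.
Local Open Scope ring_scope.

#[short(type="finNormedModType")]
HB.structure Definition FinNormedModule (K : numFieldType) :=
  {V of NormedModule K V & Vector K V}.

HB.instance Definition _ (K : numFieldType) := NormedModule.on K^o.
HB.instance Definition _ (K : numFieldType) m n :=
  NormedModule.on 'M[K]_(m, n).

Section Boundedness.
Variable R : realType.

Lemma rV_linear_bound n (W : normedModType R) (h : {linear 'rV[R]_n -> W}) :
  exists2 C : R, 0 <= C & forall u, `|h u| <= C * `|u|.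
Proof.
exists (\sum_(i < n) `|h (delta_mx 0 i)|); first exact: sumr_ge0.
move=> u; rewrite {1}[u]row_sum_delta linear_sum mulr_suml.
apply: le_trans (ler_norm_sum _ _ _) _; apply: ler_sum => i _.
rewrite linearZ /= normrZ mulrC ler_wpM2l //.
by rewrite [`|u|]mx_normrE (le_trans _ (le_bigmax _ _ (0, i))).
Qed.

Lemma rV_linear_continuous n (W : normedModType R) (h : {linear 'rV[R]_n -> W}) :
  continuous h.
Proof.
have [C _ hC] := rV_linear_bound h.
apply: bounded_linear_continuous; apply/linear_boundedP.
near=> M => u; apply: le_trans (hC u) _; rewrite ler_wpM2r //.
Unshelve. all: by end_near.
Qed.

Lemma v2r_bound (Z : finNormedModType R) :
  exists2 m : R, 0 < m & forall z : Z, m * `|v2r z| <= `|z|.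
Proof.
pose B := [set u : 'rV[R]_(dim Z) | `|u| = 1].
have normB (u : 'rV[R]_(dim Z)) : u != 0 -> B (`|u|^-1 *: u).
  by move=> u0; rewrite /B /= normrZ normfV normr_id mulVf // normr_eq0.
have [B0|/set0P[u0 Bu0]] := eqVneq B set0.
  exists 1 => // z; suff -> : z = 0 by rewrite linear0 !normr0 mulr0.
  apply: (can_inj v2rK); rewrite linear0; apply: contrapT => /eqP z0.
  by have := normB _ z0; rewrite B0.
have cN : continuous (fun u : 'rV[R]_(dim Z) => `|r2v u : Z|).
  move=> u; apply: (@continuous_comp _ _ _ (r2v : 'rV[R]_(dim Z) -> Z)
    (fun z => `|z|)); last exact: norm_continuous.
  exact: (@rV_linear_continuous _ Z r2v).
have cB : compact B.
  apply: bounded_closed_compact.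
    exists 1; split; first exact: num_real.
    by move=> M M1 u /= ->; exact: ltW.
  have -> : B = (fun u : 'rV[R]_(dim Z) => `|u|) @^-1` [set 1] by [].
  by apply: closed_comp => [u _|]; [exact: norm_continuous|exact: closed_eq].
have [||c Bc minc] := @EVT_min_rV R _ (fun u => `|r2v u : Z|) B _ cB.
- by exists u0.
- exact: continuous_subspaceT.
have Bc1 : `|c| = 1 by move: Bc; rewrite inE.
exists `|r2v c : Z|.
  rewrite normr_gt0; apply: contraPneq Bc1 => rc0.
  suff -> : c = 0 by rewrite normr0 => /esym/eqP; rewrite oner_eq0.
  by apply: (can_inj r2vK); rewrite rc0 linear0.
move=> z; have [->|z0] := eqVneq (v2r z) 0; first by rewrite normr0 mulr0.
have nz : 0 < `|v2r z| by rewrite normr_gt0.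
have := minc _ (mem_set (normB _ z0)).
by rewrite linearZ /= v2rK normrZ normfV normr_id mulrC ler_pdivlMr.
Qed.

Lemma lfun_bound (Z : finNormedModType R) (f : 'Hom(Z, R^o)) :
  exists2 C : R, 0 <= C & forall z : Z, `|f z| <= C * `|z|.
Proof.
have [m m0 hm] := v2r_bound Z.
have [C C0 hC] := rV_linear_bound (f \o (r2v : {linear _ -> _})).
exists (C / m); first by rewrite divr_ge0 // ltW.
move=> z; have := hC (v2r z); rewrite /= v2rK => /le_trans; apply.
by rewrite -mulrA ler_wpM2l // ler_pdivlMl.
Qed.

End Boundedness.

Section SubspaceNorm.
Variables (R : realType) (X : finNormedModType R) (Y : {vspace X}).

Let subvs_norm (y : subvs_of Y) : R := `|vsval y|.

Let subvs_normD x y : subvs_norm (x + y) <= subvs_norm x + subvs_norm y.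
Proof. by rewrite /subvs_norm linearD ler_normD. Qed.

Let subvs_normZ (a : R) y : subvs_norm (a *: y) = `|a| * subvs_norm y.
Proof. by rewrite /subvs_norm linearZ normrZ. Qed.

Let subvs_norm_eq0 y : subvs_norm y = 0 -> y = 0.
Proof. by move=> /normr0_eq0 y0; apply: val_inj. Qed.

HB.instance Definition _ := @Lmodule_isNormed.Build R (subvs_of Y)
  subvs_norm subvs_normD subvs_normZ subvs_norm_eq0.

End SubspaceNorm.

Definition unit_ball (R : realType) (Z : finNormedModType R) : set Z :=
  [set z | `|z| <= 1].

Definition unit_sphere (R : realType) (Z : finNormedModType R) : set Z :=
  [set z | `|z| = 1].

(* In finite dimension every linear functional is bounded (lfun_bound), so the
   topological dual consists of all linear functionals. *)
Definition dual_space (R : realType) (Z : finNormedModType R) : Type :=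
  'Hom(Z, R^o).

HB.instance Definition _ (R : realType) (Z : finNormedModType R) :=
  Vector.on (@dual_space R Z).

Section DualNorm.
Variables (R : realType) (Z : finNormedModType R).
Implicit Types f g : dual_space Z.

Definition dual_norm f : R := sup [set `|f z| | z in @unit_ball R Z].

Let dual_norm_has_sup f : has_sup [set `|f z| | z in @unit_ball R Z].
Proof.
split; first by exists `|f 0|, 0 => //; rewrite /unit_ball /= normr0.
have [C C0 hC] := lfun_bound f.
by exists C => _ [z /= z1 <-]; apply: le_trans (hC z) _; rewrite ler_piMr.
Qed.

Let dual_norm_ub f z : unit_ball z -> `|f z| <= dual_norm f.
Proof. by move=> z1; apply: (ub_le_sup (dual_norm_has_sup f).2); exists z. Qed.

Let dual_norm_lub f c :
  (forall z, unit_ball z -> `|f z| <= c) -> dual_norm f <= c.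
Proof.
move=> fc; apply: ge_sup; first exact: (dual_norm_has_sup f).1.
by move=> _ [z z1 <-]; exact: fc.
Qed.

Let dual_normD f g : dual_norm (f + g) <= dual_norm f + dual_norm g.
Proof.
apply: dual_norm_lub => z z1; rewrite lfunE /=.
by rewrite (le_trans (ler_normD _ _)) // lerD // dual_norm_ub.
Qed.

Let dual_norm_ge0 f : 0 <= dual_norm f.
Proof.
by apply: le_trans (@dual_norm_ub f 0 _) => //; rewrite /unit_ball /= normr0.
Qed.

Let dual_normZ_le (a : R) f : dual_norm (a *: f) <= `|a| * dual_norm f.
Proof.
apply: dual_norm_lub => z z1; rewrite lfunE /= normrZ.
by rewrite ler_wpM2l // dual_norm_ub.
Qed.

Let dual_normZ (a : R) f : dual_norm (a *: f) = `|a| * dual_norm f.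
Proof.
apply/eqP; rewrite eq_le dual_normZ_le /=.
have [->|a0] := eqVneq a 0; first by rewrite normr0 mul0r dual_norm_ge0.
rewrite -ler_pdivlMl ?normr_gt0 // -normfV.
by apply: le_trans (dual_normZ_le _ _); rewrite scalerA mulVf // scale1r.
Qed.

Let dual_norm_eq0 f : dual_norm f = 0 -> f = 0.
Proof.
move=> f0; apply/lfunP => z; rewrite lfunE /=.
have [->|z0] := eqVneq z 0; first by rewrite linear0.
have nz : 0 < `|z| by rewrite normr_gt0.
have /dual_norm_ub : unit_ball (`|z|^-1 *: z).
  by rewrite /unit_ball /= normrZ normfV normr_id mulVf // gt_eqF.
move=> /(_ f); rewrite f0 linearZ /= normrZ normfV normr_id.
by rewrite pmulr_rle0 ?invr_gt0 // normr_le0 => /eqP.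
Qed.

HB.instance Definition _ := @Lmodule_isNormed.Build R (dual_space Z)
  dual_norm dual_normD dual_normZ dual_norm_eq0.

End DualNorm.

Definition extreme_points (R : realType) (V : lmodType R) (A : set V) : set V :=
  [set z | A z /\ forall x y (t : R), A x -> A y -> 0 < t < 1 ->
     z = t *: x + (1 - t) *: y -> x = z /\ y = z].

Definition polyhedron (R : realType) (Z : finNormedModType R) (A : set Z) :=
  exists2 s : seq (dual_space Z * R), (forall h, h \in s -> h.1 != 0) &
    A = [set z | forall h, h \in s -> h.1 z <= h.2].

Definition polyhedral_space (R : realType) (Z : finNormedModType R) : Prop :=
  polyhedron (@unit_ball R Z).

Definition smooth_points (R : realType) (Z : finNormedModType R) : set Z :=
  [set z | unit_sphere z /\
     exists! phi : dual_space Z, unit_sphere phi /\ phi z = 1].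

(* Smoothness in the normed space `dual_space Z`, so the supporting functionals
   range over the bidual `dual_space (dual_space Z)`. *)
Definition smooth_functional (R : realType) (Z : finNormedModType R)
  (f : dual_space Z) : Prop := smooth_points f.

Definition norm_attainment_set (R : realType) (Z : finNormedModType R)
    (f : dual_space Z) : set Z :=
  [set z | unit_sphere z /\ f z = `|f|].

(* Main.v *)
From HB Require Import structures.
Require Import Defs.
From mathcomp Require Import all_boot all_order all_algebra.
From mathcomp Require Import all_classical all_reals all_analysis.
From mathcomp Require Import lra.
Import Order.TTheory GRing.Theory Num.Theory.
Import numFieldNormedType.Exports.
Import VectorInternalTheory.
Local Open Scope classical_set_scope.
Local Open Scope ring_scope.
Set Implicit Arguments.
Unset Strict Implicit.

(** A finite-dimensional normed space Z is reflexive, so a functional f on Z is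
    a smooth point of the dual ball exactly when |f| = 1 and f takes
    the value 1 at exactly one point of the unit sphere of Z
    ([smooth_functionalP]); existence of such a point is compactness of the
    ball.

    If F is a smooth extension of f, the unique norming point y0 of f is also
    the unique norming point of F, and a unique norming point is extreme
    ([unique_norming_extreme]).

    Conversely, let the unique norming point y0 of f be extreme in B_X, and
    write B_X as the set of all z with g z <= 1 for finitely many g. Let act be
    the set of those g with g y0 = 1.
    - Since y0 is extreme, no nonzero vector is annihilated by all of act
      ([extreme_active_sep]).
    - On the cone of the y in Y with g y <= 0 for all g in act, f is negative
      off the origin, since otherwise f would also attain its norm at y0 + t y
      for a small t > 0. By compactness f y <= - d |y| there, for some 0 < d <= 1
      ([restriction_gap]).
    - Consequently f <= p on Y, where p is the sublinear function
      p x = (1 - d) max_act (g x) + d avg_act (g x): subtract from y the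
      multiple of y0 that brings the maximum to 0, and use avg_act >= - |.|.
      The Hahn-Banach theorem extends f to F <= p on X.
    - On B_X one has p <= 1, and F x = 1 forces avg_act (g x) = 1, hence
      g x = 1 for all g in act, that is, x = y0. So F is smooth
      ([smooth_extension]).
    The term d avg_act is what makes the extension smooth: the maximum alone
    would only give a norm-preserving one. *)

(** * The Hahn-Banach theorem in finite dimension *)

Section HahnBanach.
Variables (R : realType) (V : vectType R) (p : V -> R).
Hypothesis pD : forall x y, p (x + y) <= p x + p y.
Hypothesis pZ : forall (t : R) x, 0 < t -> p (t *: x) <= t * p x.

Lemma functional_off_subspace (U : {vspace V}) (v : V) : v \notin U ->
  exists2 l : 'Hom(V, R^o), l v = 1 & forall u, u \in U -> l u = 0.
Proof.
move=> vU.
have v0 : v != 0 by apply: contraNneq vU => ->; exact: mem0v.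
have vUd : (<[v]> :&: U = 0)%VS.
  apply/eqP; rewrite -subv0; apply/subvP => x /memv_capP[/vlineP[k ->] kU].
  have [->|k0] := eqVneq k 0; first by rewrite scale0r mem0v.
  by move: kU; rewrite rpredZeq (negPf k0) (negPf vU).
have fv : free [tuple v] by rewrite /= seq1_free.
exists (linfun (coord [tuple v] 0 : V -> R^o) \o daddv_pi <[v]> U)%VF.
  rewrite lfunE /= lfunE /= daddv_pi_id ?memv_line //.
  by have := coord_free 0 0 fv; rewrite /= => ->.
move=> u uU; rewrite lfunE /=.
have -> : daddv_pi <[v]> U u = 0; last by rewrite linear0.
have UVd : (U :&: <[v]> = 0)%VS by rewrite capvC.
have := daddv_pi_add vUd (subvP (addvSr _ _) _ uU).
rewrite (daddv_pi_id UVd uU) => /eqP; rewrite -subr_eq0 addrK => /eqP //.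
Qed.

(** One-dimensional extension: the value c at v must lie between
    f u - p (u - v) and p (u + v) - f u for all u in U. *)
Lemma hahn_banach_step (U : {vspace V}) (f : 'Hom(V, R^o)) (v : V) :
    v \notin U -> (forall u, u \in U -> f u <= p u) ->
  exists2 g : 'Hom(V, R^o), (forall u, u \in U -> g u = f u) &
    forall x, x \in (U + <[v]>)%VS -> g x <= p x.
Proof.
move=> vU fp.
pose A := [set f u - p (u - v) | u in [set u | u \in U]].
have A0 : A !=set0 by exists (f 0 - p (0 - v)), 0 => //=; exact: mem0v.
have fA u u' : u \in U -> u' \in U -> f u - p (u - v) <= p (u' + v) - f u'.
  move=> uU u'U; rewrite lerBlDr -addrAC lerBrDr -linearD /=.
  rewrite (le_trans (fp _ (memvD uU u'U))) //.
  by have := pD (u' + v) (u - v); rewrite addrACA subrr addr0 (addrC u').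
have Aub : has_ubound A.
  by exists (p (0 + v) - f 0) => _ [u uU <-]; apply: fA => //; exact: mem0v.
pose c := sup A.
have c_ge u : u \in U -> f u - p (u - v) <= c.
  by move=> uU; apply: ub_le_sup => //; exists u.
have c_le u : u \in U -> c <= p (u + v) - f u.
  by move=> uU; apply: ge_sup => // _ [u' u'U <-]; exact: fA.
have [l lv lU] := functional_off_subspace vU.
exists (f + (c - f v) *: l).
  by move=> u uU; rewrite !lfunE /= lfunE /= lU // scaler0 addr0.
move=> _ /memv_addP[u uU [_ /vlineP[t ->] ->]].
have -> : (f + (c - f v) *: l) (u + t *: v) = f u + t * c.
  rewrite add_lfunE scale_lfunE !linearD !linearZ /= lU // lv.
  by rewrite /GRing.scale /=; lra.
have [t0|t0|->] := ltgtP t 0; last first.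
- by rewrite mul0r scale0r !addr0 fp.
- have := c_le (t^-1 *: u) (memvZ _ uU).
  have ti : 0 < t^-1 by rewrite invr_gt0.
  have := pZ (u + t *: v) ti.
  rewrite scalerDr scalerA mulVf ?gt_eqF // scale1r linearZ /= => h1 h2.
  have : c <= t^-1 * (p (u + t *: v) - f u).
    by rewrite mulrBr; apply: le_trans h2 _; rewrite lerB.
  by rewrite ler_pdivlMl // lerBrDl.
- have si : 0 < (- t)^-1 by rewrite invr_gt0 oppr_gt0.
  have := c_ge ((- t)^-1 *: u) (memvZ _ uU).
  have := pZ (u + t *: v) si.
  rewrite scalerDr scalerA {2}invrN mulNr mulVf ?lt_eqF //.
  rewrite scaleN1r linearZ /= => h1 h2.
  have : (- t)^-1 * (f u - p (u + t *: v)) <= c.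
    by rewrite mulrBr; apply: le_trans h2; rewrite lerB.
  by rewrite ler_pdivrMl ?oppr_gt0 // mulNr; lra.
Qed.

(** A functional on the subspace U is represented by any of its linear
    extensions to V, only its values on U being constrained. *)
Lemma hahn_banach (U : {vspace V}) (f : 'Hom(V, R^o)) :
    (forall u, u \in U -> f u <= p u) ->
  exists2 g : 'Hom(V, R^o), (forall u, u \in U -> g u = f u) &
    forall x, g x <= p x.
Proof.
have [n] := ubnP (\dim {:V} - \dim U)%N.
elim: n U f => // n IH U f leUn fp.
have [/subvP VU|/subvPn[v _ vU]] := boolP ({:V} <= U)%VS.
  by exists f => // x; apply: fp; exact/VU/memvf.
have [g gf gp] := hahn_banach_step vU fp.
have dimlt : (\dim U < \dim (U + <[v]>))%N.
  rewrite ltn_neqAle dimvS ?addvSl // andbT.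
  apply: contraNneq vU => /eqP dd.
  have /eqP -> : U == (U + <[v]>)%VS by rewrite eqEdim addvSl -(eqP dd) /=.
  exact/(subvP (addvSr _ _))/memv_line.
have [||h hg hp] := IH (U + <[v]>)%VS g.
- rewrite ltnS in leUn; apply: leq_trans leUn; rewrite ltn_sub2l //.
  by apply: leq_trans dimlt (dimvS (subvf _)).
- exact: gp.
exists h => // u uU; rewrite hg ?gf //; exact: (subvP (addvSl _ _)).
Qed.

End HahnBanach.

(** * The dual norm and norm attainment *)

Section DualNormTheory.
Variables (R : realType) (Z : finNormedModType R).
Implicit Types f : dual_space Z.

Lemma ler_dual_norm f (z : Z) : `|f z| <= `|f| * `|z|.
Proof.
have [->|z0] := eqVneq z 0; first by rewrite linear0 !normr0 mulr0.
have nz : 0 < `|z| by rewrite normr_gt0.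
rewrite -ler_pdivrMr // mulrC.
have -> : `|z|^-1 * `|f z| = `|f (`|z|^-1 *: z)|.
  by rewrite linearZ /= normrZ normfV normr_id.
apply: ub_le_sup; last first.
  exists (`|z|^-1 *: z) => //.
  by rewrite /unit_ball /= normrZ normfV normr_id mulVf // gt_eqF.
have [C C0 hC] := lfun_bound f.
by exists C => _ [x /= x1 <-]; apply: le_trans (hC x) _; rewrite ler_piMr.
Qed.

(** No absolute value is needed on f z, by symmetry of the ball. *)
Lemma dual_norm_le f (c : R) :
  (forall z, unit_ball z -> f z <= c) -> `|f| <= c.
Proof.
move=> fc; apply: ge_sup.
  by exists `|f 0|, 0 => //; rewrite /unit_ball /= normr0.
move=> _ [z z1 <-]; rewrite ler_norml fc // andbT lerNl -linearN fc //.
by rewrite /unit_ball /= normrN.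
Qed.

Lemma dual_continuous f : continuous f.
Proof.
have [C _ hC] := lfun_bound f.
apply: bounded_linear_continuous; apply/linear_boundedP.
near=> M => u; apply: le_trans (hC u) _; rewrite ler_wpM2r //.
Unshelve. all: by end_near.
Qed.

(** The ball is the continuous image, under the coordinate isomorphism, of a
    closed bounded set of row vectors. *)
Lemma unit_ball_compact : compact (@unit_ball R Z).
Proof.
pose B := [set u : 'rV[R]_(dim Z) | `|r2v u : Z| <= 1].
have cr : continuous (r2v : 'rV[R]_(dim Z) -> Z).
  exact: (@rV_linear_continuous R _ Z r2v).
have -> : @unit_ball R Z = (r2v : 'rV[R]_(dim Z) -> Z) @` B.
  rewrite eqEsubset; split => [z z1|_ [u u1 <-] //].
  by exists (v2r z); rewrite /B /= v2rK.
apply: continuous_compact; first exact: continuous_subspaceT.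
apply: bounded_closed_compact.
  have [m m0 hm] := v2r_bound Z.
  exists m^-1; split; first exact: num_real.
  move=> M M1 u u1; apply: le_trans (ltW M1).
  rewrite -[_^-1]mulr1 ler_pdivlMl //; apply: le_trans u1.
  by have := hm (r2v u); rewrite r2vK.
apply: (@closed_comp _ _ (fun u : 'rV[R]_(dim Z) => `|r2v u : Z|)
  [set x : R | x <= 1]); last exact: closed_le.
move=> u _; apply: (@continuous_comp _ _ _ (r2v : 'rV[R]_(dim Z) -> Z)
    (fun z => `|z|)); last exact: norm_continuous.
exact: cr.
Qed.

Lemma dual_max (A : set Z) f : A !=set0 -> closed A -> A `<=` @unit_ball R Z ->
  exists2 z, A z & forall w, A w -> f w <= f z.
Proof.
move=> A0 cA A1.
have Ac := subclosed_compact cA unit_ball_compact A1.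
have [|z Az zmax] := @compact_EVT_max Z R f A A0 Ac.
  by apply: continuous_subspaceT; exact: dual_continuous.
by exists z => [|w Aw]; [exact: set_mem|apply: zmax; exact: mem_set].
Qed.

Lemma norm_attained f : `|f| = 1 -> exists2 z, unit_sphere z & f z = 1.
Proof.
move=> f1; have [||//|z z1 zmax] := @dual_max (@unit_ball R Z) f.
- by exists 0; rewrite /unit_ball /= normr0.
- apply: (@closed_comp _ _ (fun u : Z => `|u|) [set x : R | x <= 1]).
    by move=> u _; exact: norm_continuous.
  exact: closed_le.
have fz1 : 1 <= f z by rewrite -f1; exact: dual_norm_le.
have := ler_dual_norm f z; rewrite f1 mul1r => fz.
have zE : `|z| = 1.
  apply/eqP; rewrite eq_le z1 /=.
  exact: le_trans fz1 (le_trans (ler_norm _) fz).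
exists z => //; apply/eqP; rewrite eq_le fz1 andbT.
by rewrite -zE (le_trans (ler_norm _)).
Qed.

End DualNormTheory.

(** * Reflexivity and smooth functionals *)

Section Bidual.
Variables (R : realType) (Z : finNormedModType R).
Implicit Types f : dual_space Z.

(** Evaluation at z, as a plain function of the functional. *)
Definition evaluation (z : Z) : dual_space Z -> R^o := fun f => f z.

Lemma evaluation_is_linear (z : Z) : linear (evaluation z).
Proof. by move=> a f g; rewrite /evaluation add_lfunE scale_lfunE. Qed.

HB.instance Definition _ (z : Z) :=
  GRing.isLinear.Build R (dual_space Z) R^o *:%R (evaluation z)
    (evaluation_is_linear z).

(** The canonical map from Z to its bidual. *)
Definition bidual (z : Z) : dual_space (dual_space Z) :=
  linfun (evaluation z).

Lemma bidualE z f : bidual z f = f z.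
Proof. by rewrite lfunE. Qed.

Lemma bidual_inj : injective bidual.
Proof.
move=> x y xy; rewrite (coord_vbasis (memvf x)) (coord_vbasis (memvf y)).
apply: eq_bigr => i _; congr (_ *: _).
have := congr1 (fun phi : dual_space (dual_space Z) =>
  phi (linfun (coord (vbasis {:Z}) i : Z -> R^o))) xy.
by rewrite /= !bidualE !lfunE.
Qed.

Lemma bidual_surj (phi : dual_space (dual_space Z)) :
  exists z, phi = bidual z.
Proof.
pose c i : dual_space Z := linfun (coord (vbasis {:Z}) i : Z -> R^o).
exists (\sum_(i < \dim {:Z}) (phi (c i) : R) *: (vbasis {:Z})`_i).
apply/lfunP => f; rewrite bidualE linear_sum /=.
have {1}-> : f = \sum_(i < \dim {:Z}) (f (vbasis {:Z})`_i : R) *: c i.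
  apply/lfunP => z; rewrite {1}(coord_vbasis (memvf z)) linear_sum sum_lfunE.
  by apply: eq_bigr => i _; rewrite linearZ scale_lfunE lfunE /= [LHS]mulrC.
rewrite linear_sum; apply: eq_bigr => i _; rewrite !linearZ /=.
by rewrite [LHS]mulrC.
Qed.

End Bidual.

Section SmoothFunctional.
Variables (R : realType) (Z : finNormedModType R).
Implicit Types f : dual_space Z.

(** Hahn-Banach applied to the norm, starting from the line through z. *)
Lemma norming_functional (z : Z) :
  exists2 f : dual_space Z, `|f| <= 1 & f z = `|z|.
Proof.
have [->|z0] := eqVneq z 0.
  by exists 0; rewrite ?normr0 // linear0.
have [l lz _] := @functional_off_subspace R Z 0%VS z ltac:(by rewrite memv0).
have [|||g gz gle] := @hahn_banach R Z (fun x => `|x|) _ _ <[z]>%VS (`|z| *: l).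
- exact: ler_normD.
- by move=> t x t0; rewrite normrZ gtr0_norm.
- move=> _ /vlineP[k ->].
  rewrite scale_lfunE linearZ /= lz normrZ [_%:A]mulr1 [X in X <= _]mulrC.
  by apply: ler_wpM2r => //; exact: ler_norm.
exists g; first by apply: dual_norm_le => x; exact: le_trans.
by rewrite gz ?memv_line // scale_lfunE lz [LHS]mulr1.
Qed.

Lemma norm_bidual (z : Z) : `|bidual z| = `|z|.
Proof.
apply/eqP; rewrite eq_le; apply/andP; split.
  apply: dual_norm_le => f f1; rewrite bidualE (le_trans (ler_norm _)) //.
  by rewrite (le_trans (ler_dual_norm _ _)) // ler_piMl.
have [f f1 fz] := norming_functional z.
rewrite -fz -(bidualE z f) (le_trans (ler_norm _)) //.
by rewrite (le_trans (ler_dual_norm _ _)) // ler_piMr.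
Qed.

(** Smoothness of f in the dual space means that f attains its norm at a single
    point; existence of that point is automatic ([norm_attained]). *)
Lemma smooth_functionalP f : smooth_functional f <->
  `|f| = 1 /\ forall x y, unit_sphere x -> unit_sphere y ->
    f x = 1 -> f y = 1 -> x = y.
Proof.
split=> [[f1 [phi [_ uphi]]]|[f1 uf]]; split => //.
  move=> x y x1 y1 fx fy; apply: bidual_inj.
  by rewrite -(uphi (bidual x)) ?(uphi (bidual y)) //;
    rewrite /unit_sphere /= norm_bidual bidualE.
have [z z1 fz] := norm_attained f1.
exists (bidual z); split; first by rewrite /unit_sphere /= norm_bidual bidualE.
move=> phi []; have [x ->] := bidual_surj phi.
rewrite /unit_sphere /= norm_bidual bidualE => x1 fx.
by congr bidual; exact: uf.
Qed.

End SmoothFunctional.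

(** * Extreme points of polyhedral balls *)

Lemma sumr_const_size (R : nzRingType) (I : Type) (l : seq I) (c : R) :
  \sum_(i <- l) c = c *+ size l.
Proof. by rewrite big_const_seq count_predT iter_addr_0. Qed.

Section Extreme.
Variables (R : realType) (Z : finNormedModType R).

Lemma unique_norming_extreme (f : dual_space Z) (z : Z) :
    `|f| = 1 -> unit_sphere z -> f z = 1 ->
    (forall x, unit_sphere x -> f x = 1 -> x = z) ->
  extreme_points (@unit_ball R Z) z.
Proof.
move=> f1 z1 fz fu; split; first by rewrite /unit_ball /= z1.
have fle x : unit_ball x -> f x <= 1.
  move=> x1; rewrite (le_trans (ler_norm _)) //.
  by rewrite (le_trans (ler_dual_norm _ _)) // f1 mul1r.
have eqz x : unit_ball x -> 1 <= (f x : R) -> x = z.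
  move=> x1 fx; apply: fu; last by apply/eqP; rewrite eq_le fle.
  apply/eqP; rewrite eq_le x1 /= (le_trans fx) // (le_trans (ler_norm _)) //.
  by rewrite (le_trans (ler_dual_norm _ _)) // f1 mul1r.
move=> x y t x1 y1 /andP[t0 t1] zE.
have fxy : t * f x + (1 - t) * f y = 1 :> R.
  by have := fz; rewrite zE linearD !linearZ.
have fx1 : (f x : R) <= 1 := fle _ x1; have fy1 : (f y : R) <= 1 := fle _ y1.
by split; apply: eqz => //; nra.
Qed.

(** The functionals in s describe the unit ball: it is the intersection of the
    half-spaces g <= 1 for g in s. *)
Definition cuts_unit_ball (s : seq (dual_space Z)) :=
  forall z, unit_ball z <-> forall g, g \in s -> g z <= 1.

(** The right-hand sides of the inequalities defining a polyhedral ball are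
    positive because 0 is an interior point, so they can be normalized to 1. *)
Lemma polyhedral_cuts_unit_ball : polyhedral_space Z ->
  exists s, cuts_unit_ball s.
Proof.
move=> [s s0 sE]; exists [seq h.2^-1 *: h.1 | h <- s].
have ballE z : unit_ball z <-> forall h, h \in s -> h.1 z <= h.2 by rewrite sE.
have pos h : h \in s -> 0 < h.2.
  move=> hs; rewrite ltNge; apply/negP => h2; have /eqP := s0 h hs; apply.
  have le0 z : h.1 z <= 0.
    have [->|z0] := eqVneq z 0; first by rewrite linear0.
    have nz : 0 < `|z| by rewrite normr_gt0.
    have /ballE/(_ h hs) : unit_ball (`|z|^-1 *: z).
      by rewrite /unit_ball /= normrZ normfV normr_id mulVf // gt_eqF.
    move=> /le_trans/(_ h2); rewrite linearZ /=.
    by rewrite pmulr_rle0 // invr_gt0.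
  apply/lfunP => z; rewrite zero_lfunE; apply/eqP; rewrite eq_le le0 /=.
  by rewrite -oppr_le0 -linearN le0.
move=> z; rewrite ballE; split=> [sz _ /mapP[h hs ->]|sz h hs].
  by rewrite scale_lfunE ler_pdivrMl ?mulr1 ?sz ?pos.
have := sz _ (map_f (fun h => h.2^-1 *: h.1) hs).
by rewrite scale_lfunE ler_pdivrMl ?mulr1 ?pos.
Qed.

Lemma cutting_norm_le1 (s : seq (dual_space Z)) g :
  cuts_unit_ball s -> g \in s -> `|g| <= 1.
Proof. by move=> sE gs; apply: dual_norm_le => z /sE; exact. Qed.

(** The functionals of s whose inequality g <= 1 is tight at z. *)
Definition active_functionals (s : seq (dual_space Z)) (z : Z) :=
  [seq g : dual_space Z <- s | g z == 1].

(** From a point z of the ball one can move some distance within the ball in any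
    direction along which no active functional increases: the inactive
    inequalities have some slack. *)
Lemma active_direction s (z w : Z) : cuts_unit_ball s -> unit_ball z ->
    (forall g, g \in active_functionals s z -> g w <= 0) ->
  exists2 t : R, 0 < t & unit_ball (z + t *: w).
Proof.
move=> sE /sE z1 wle.
suff [t t0 ht] : exists2 t : R, 0 < t &
    forall g, g \in s -> g (z + t *: w) <= 1.
  by exists t => //; exact/sE.
have : forall g, g \in s -> g z = 1 -> g w <= 0.
  by move=> g gs gz; apply: wle; rewrite mem_filter gz eqxx.
elim: {sE wle} s z1 => [|g s IH] z1 wle; first by exists 1.
have [||t t0 ht] := IH.
- by move=> h hs; apply: z1; rewrite inE hs orbT.
- by move=> h hs; apply: wle; rewrite inE hs orbT.
have gz := z1 g (mem_head _ _).
have gw := wle g (mem_head _ _).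
have [u u0 hu] : exists2 u : R, 0 < u &
    forall r, 0 < r -> r <= u -> g z + r * g w <= 1.
  have [gz1|gz1] := eqVneq (g z) 1.
    by exists 1 => // r r0 _; have := gw gz1; nra.
  have {}gz1 : 0 < 1 - g z by rewrite subr_gt0 lt_neqAle gz1.
  have aw : 0 < `|g w| + 1 by rewrite ltr_wpDl.
  (* The slack 1 - g z divided by a bound on the slope; the added 1 keeps the
     denominator positive when g w = 0. *)
  exists ((1 - g z) / (`|g w| + 1)); first by rewrite divr_gt0.
  move=> r r0; rewrite ler_pdivlMr //; have := ler_norm (g w); nra.
have lin (h : dual_space Z) r : h (z + r *: w) = h z + r * h w :> R.
  by rewrite linearD linearZ.
have tu0 : 0 < Num.min t u by rewrite lt_min t0.
exists (Num.min t u) => // h; rewrite inE lin => /predU1P[->|hs].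
  by apply: hu => //; rewrite ge_min lexx orbT.
have := ht h hs; have := z1 h; rewrite inE hs orbT lin => /(_ isT).
have : Num.min t u <= t by rewrite ge_min lexx.
nra.
Qed.

Lemma extreme_active_sep s (z w : Z) : cuts_unit_ball s ->
    extreme_points (@unit_ball R Z) z ->
    (forall g, g \in active_functionals s z -> g w = 0) ->
  w = 0.
Proof.
move=> sE [z1 zext] gw.
have [|t t0 zt] := active_direction (w := w) sE z1.
  by move=> g /gw ->.
have [|u u0 zu] := active_direction (w := - w) sE z1.
  by move=> g /gw gw0; rewrite linearN /= gw0 oppr0.
have tu0 : 0 < t + u by rewrite addr_gt0.
(* The weight makes z the combination of z + t w and z - u w. *)
have [||] := zext _ _ (u / (t + u)) zt zu.
- by rewrite divr_gt0 //= ltr_pdivrMr // mul1r ltrDr.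
- have -> : 1 - u / (t + u) = t / (t + u).
    by rewrite -[X in X - _](@divff _ (t + u)) ?gt_eqF // -mulrBl addrK.
  rewrite !scalerDr addrACA -scalerDl -mulrDl [u + t]addrC divff ?gt_eqF //.
  rewrite scale1r scalerN scalerN !scalerA mulrAC [t / _ * u]mulrAC [u * t]mulrC.
  by rewrite subrr addr0.
move=> /eqP; rewrite -subr_eq0 addrAC subrr add0r scaler_eq0 gt_eqF //=.
by move=> /eqP.
Qed.

End Extreme.

(** * Smooth extensions from a subspace *)

Section Extension.
Variables (R : realType) (X : finNormedModType R) (Y : {vspace X}).

Lemma norm_subvs (y : subvs_of Y) : `|vsval y| = `|y|.
Proof. by []. Qed.

(** If y0 is the only norming point of f, then f is uniformly negative on the
    cone of directions along which no functional active at y0 increases. *)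
Lemma restriction_gap s (f : dual_space (subvs_of Y)) (y0 : subvs_of Y) :
    @cuts_unit_ball R X s -> `|f| = 1 -> unit_sphere y0 -> f y0 = 1 ->
    (forall y, unit_sphere y -> f y = 1 -> y = y0) ->
  exists2 d : R, 0 < d <= 1 & forall y,
    (forall g, g \in active_functionals s (vsval y0) -> g (vsval y) <= 0) ->
    f y <= - (d * `|y|).
Proof.
move=> sE f1 y01 fy0 fu.
set act := active_functionals _ _.
have fle y : unit_ball y -> f y <= 1.
  move=> y1; rewrite (le_trans (ler_norm _)) //.
  by rewrite (le_trans (ler_dual_norm _ _)) // f1 mul1r.
have y0B : unit_ball (vsval y0) by rewrite /unit_ball /= norm_subvs y01.
have fneg y : (forall g, g \in act -> g (vsval y) <= 0) -> y != 0 -> f y < 0.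
  move=> gy; apply: contraNlt => fy.
  have [t t0 ty] := active_direction sE y0B gy.
  have {}ty : unit_ball (y0 + t *: y).
    by move: ty; rewrite /unit_ball /= -linearZ -linearD.
  have f1' : f (y0 + t *: y) = 1.
    apply/eqP; rewrite eq_le fle //= linearD linearZ /= fy0 lerDl.
    by rewrite mulr_ge0 // ltW.
  have /eqP : y0 + t *: y = y0.
    apply: fu => //; apply/eqP; rewrite eq_le ty /= -f1' -[leRHS]mul1r -f1.
    exact: le_trans (ler_norm _) (ler_dual_norm _ _).
  by rewrite -subr_eq0 addrAC subrr add0r scaler_eq0 gt_eqF.
pose K := @unit_sphere R (subvs_of Y) `&`
  \bigcap_(g in [set g | g \in act])
    [set y | (linfun (g \o vsval) : dual_space (subvs_of Y)) y <= 0].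
have KE y : K y <-> `|y| = 1 /\ forall g, g \in act -> g (vsval y) <= 0.
  by split=> -[y1 gy]; split=> // g /gy /=; rewrite lfunE.
have Ky0 : K (- y0).
  apply/KE; rewrite normrN; split => // g; rewrite mem_filter => /andP[/eqP gy _].
  by rewrite linearN /= gy lerN10.
have [|||w Kw wmax] := @dual_max R (subvs_of Y) K f.
- by exists (- y0).
- apply: closedI.
    apply: (@closed_comp _ _ (fun u : subvs_of Y => `|u|) [set x : R | x = 1]).
      by move=> u _; exact: norm_continuous.
    exact: closed_eq.
  apply: closed_bigI => g _.
  apply: (@closed_comp _ _ _ [set x : R | x <= 0]); last exact: closed_le.
  by move=> u _; exact: dual_continuous.
- by move=> y [y1 _]; rewrite /unit_ball /= y1.
have [w1 gw] := (KE w).1 Kw.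
have fw : f w < 0.
  by apply: fneg => //; rewrite -normr_eq0 w1 oner_eq0.
exists (- f w).
  (* The bound d <= 1 comes from - y0, which lies in K and has f (- y0) = - 1. *)
  rewrite oppr_gt0 fw /= lerNl -fy0 -linearN; exact: wmax.
move=> y gy; have [->|y0'] := eqVneq y 0.
  by rewrite linear0 normr0 mulr0 oppr0.
have ny : 0 < `|y| by rewrite normr_gt0.
rewrite mulNr opprK -ler_pdivrMr // mulrC.
have := wmax (`|y|^-1 *: y); rewrite linearZ /=; apply.
apply/KE; split; first by rewrite normrZ normfV normr_id mulVf // gt_eqF.
by move=> g /gy gy0; rewrite !linearZ /= pmulr_rle0 // invr_gt0.
Qed.

(** The extension is dominated by the mixture p of the maximum and the average
    of the functionals active at y0. *)
Lemma smooth_extension (f : dual_space (subvs_of Y)) (y0 : subvs_of Y) :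
    polyhedral_space X -> smooth_functional f -> unit_sphere y0 -> f y0 = 1 ->
    extreme_points (@unit_ball R X) (vsval y0) ->
  exists2 F : dual_space X, smooth_functional F &
    forall y, F (vsval y) = f y.
Proof.
move=> /polyhedral_cuts_unit_ball[s sE] /smooth_functionalP[f1 fu] y01 fy0 y0ext.
have [|d /andP[d0 d1] fd] := restriction_gap sE f1 y01 fy0.
  by move=> y ? ?; exact: fu.
set act := active_functionals _ _ in fd.
have actP g : g \in act -> g (vsval y0) = 1 /\ g \in s.
  by rewrite mem_filter => /andP[/eqP].
have actB g x : g \in act -> unit_ball x -> g x <= 1.
  by move=> /actP[_ gs] /sE; apply.
have [g0 g0act] : exists g, g \in act.
  case aE : act => [|g l]; last by exists g; rewrite mem_head.
  suff vy0 : vsval y0 = 0.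
    by have /eqP := y01; rewrite -norm_subvs vy0 normr0 eq_sym oner_eq0.
  by apply: (extreme_active_sep sE y0ext) => g; rewrite -/act aE.
(* The default value g0 x is itself a value of the family, so it does not
   affect the maximum. *)
pose m x := \big[Num.max/(g0 x : R)]_(g <- act) (g x : R).
pose n : R := (size act)%:R.
have n0 : 0 < n by rewrite ltr0n; case: (act) g0act.
pose a x : R := n^-1 * \sum_(g <- act) g x.
have le_m g x : g \in act -> g x <= m x.
  move=> ga; exact: (@le_bigmax_seq _ R _ _ _ g xpredT (fun h => h x) ga).
have m_le x c : (forall g, g \in act -> g x <= c) -> m x <= c.
  by move=> gc; rewrite /m big_seq; apply: bigmax_le => [|g]; exact: gc.
have aD x y : a (x + y) = a x + a y.
  rewrite -mulrDr -big_split /=; congr (_ * _); apply: eq_bigr => g _.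
  by rewrite linearD.
have aZ t x : a (t *: x) = t * a x.
  rewrite mulrCA mulr_sumr; congr (_ * _); apply: eq_bigr => g _.
  by rewrite linearZ.
have a_le x c : (forall g, g \in act -> g x <= c) -> a x <= c.
  move=> gc; rewrite ler_pdivrMl // /n mulr_natl -sumr_const_size.
  by rewrite big_seq [leRHS]big_seq; apply: ler_sum.
have a_ge x c : (forall g, g \in act -> c <= g x) -> c <= a x.
  move=> gc; rewrite ler_pdivlMl // /n mulr_natl -sumr_const_size.
  by rewrite big_seq [leRHS]big_seq; apply: ler_sum.
have ay0 : a (vsval y0) = 1.
  by apply/eqP; rewrite eq_le a_le ?a_ge // => g /actP[->].
pose p x := (1 - d) * m x + d * a x.
have d1' : 0 <= 1 - d by rewrite subr_ge0.
have [|||F FY Fp] := @hahn_banach R X p _ _ Y (linfun (f \o vsproj Y)).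
- move=> x y; rewrite /p aD.
  have : m (x + y) <= m x + m y.
    by apply: m_le => g ga; rewrite linearD lerD // le_m.
  nra.
- move=> t x t0; rewrite /p aZ.
  have : m (t *: x) <= t * m x.
    by apply: m_le => g ga; rewrite linearZ ler_pM2l // le_m.
  nra.
- move=> x xY; rewrite lfunE /=.
  set y := vsproj Y x; have -> : x = vsval y by rewrite vsprojK.
  (* Subtracting m y times y0 moves y into the cone where fd applies. *)
  pose z := y - m (vsval y) *: y0.
  have zE : vsval z = vsval y - m (vsval y) *: vsval y0.
    by rewrite linearB linearZ.
  have gz g : g \in act -> g (vsval z) = g (vsval y) - m (vsval y) :> R.
    by move=> ga; rewrite zE linearB linearZ /= (actP g ga).1 [_ *: _]mulr1.
  have az : a (vsval z) = a (vsval y) - m (vsval y).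
    by rewrite zE aD -scaleNr aZ ay0 mulr1.
  have azn : - `|z| <= a (vsval z).
    apply: a_ge => g /actP[_ gs]; rewrite lerNl -linearN.
    rewrite (le_trans (ler_norm _)) // (le_trans (ler_dual_norm _ _)) //.
    by rewrite normrN ler_piMl // (cutting_norm_le1 sE).
  have fz : f z = f y - m (vsval y).
    by rewrite linearB linearZ /= fy0 [_ *: _]mulr1.
  rewrite /p.
  have : f z <= - (d * `|z|).
    by apply: fd => g ga; rewrite gz // subr_le0 le_m.
  move: azn; rewrite az fz; nra.
have FYf y : F (vsval y) = f y.
  by rewrite FY ?subvsP // lfunE /= vsvalK.
exists F => //; apply/smooth_functionalP.
have p_le x : unit_ball x -> p x <= 1.
  move=> x1; rewrite /p.
  have : m x <= 1 by apply: m_le => g ga; exact: actB.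
  have : a x <= 1 by apply: a_le => g ga; exact: actB.
  nra.
have y0S : unit_sphere (vsval y0) by [].
split.
  apply/eqP; rewrite eq_le dual_norm_le /=; last first.
    by move=> x x1; exact: le_trans (Fp x) (p_le x x1).
  rewrite -fy0 -FYf (le_trans (ler_norm _)) //.
  by rewrite (le_trans (ler_dual_norm _ _)) // y0S mulr1.
suff uniq x : unit_sphere x -> F x = 1 -> x = vsval y0.
  by move=> x x' x1 x'1 Fx Fx'; rewrite (uniq x) // (uniq x').
move=> x1 Fx; have xB : unit_ball x by rewrite /unit_ball /= x1.
apply/eqP; rewrite -subr_eq0; apply/eqP.
apply: (extreme_active_sep sE y0ext) => g ga.
rewrite linearB /= (actP g ga).1; apply/eqP; rewrite subr_eq0.
(* Since the average a x is at least 1 and no term exceeds 1, each is 1. *)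
have ax1 : 1 <= a x.
  have : 1 <= p x by rewrite -Fx.
  have : m x <= 1 by apply: m_le => h ha; exact: actB.
  rewrite /p; nra.
rewrite eq_le actB //=.
move: ax1; rewrite ler_pdivlMl // mulr1 (big_rem g) //=.
have : \sum_(h <- rem g act) h x <= \sum_(h <- rem g act) 1.
  by rewrite big_seq [leRHS]big_seq; apply: ler_sum => h /mem_rem ha; exact: actB.
rewrite sumr_const_size size_rem // /n -[in X in X%:R <= _](@prednK (size act)).
  by rewrite -natr1; lra.
by rewrite -(ltr0n R).
Qed.

End Extension.

Theorem theorem1p2 (R : realType) (X : finNormedModType R) (Y : {vspace X})
    (f : dual_space (subvs_of Y))
    (hX : polyhedral_space X) (hf : smooth_functional f) :
  (exists2 ft : dual_space X, smooth_functional ft &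
     forall y : subvs_of Y, ft (vsval y) = f y) <->
  (exists2 y0 : subvs_of Y, norm_attainment_set f y0 &
     extreme_points (@unit_ball R (subvs_of Y)) y0 /\
     extreme_points (@unit_ball R X) (vsval y0)).
Proof.
have /smooth_functionalP[f1 fu] := hf.
split=> [[F /smooth_functionalP[F1 Fu] FY]|[y0 [y01 fy0] [_ y0ext]]]; last first.
  by apply: (smooth_extension hX hf y01 _ y0ext); rewrite fy0.
have [y0 y01 fy0] := norm_attained f1.
exists y0; first by split=> //; rewrite f1.
split.
  by apply: (unique_norming_extreme f1) => // y y1 fy; exact: fu.
apply: (unique_norming_extreme F1) => //; first by rewrite FY.
by move=> x x1 Fx; apply: Fu => //; rewrite FY.
Qed.
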